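(* Let $X$ be a finite-dimensional GL-space. Then the closed unit ball $B_X$ is a polyhedron (an intersection of finitely many closed half-spaces), and every face of maximal dimension $\dim X-1$ (facet) of this polyhedron is plump.
   Context: All spaces are real. $B_X$ and $S_X$ denote the closed unit ball and unit sphere of a normed space $X$, and $X^*$ its dual. For a non-empty $A\subset X$, $\rho(x,A)=\inf_{a\in A}\|x-a\|$. A Banach space $X$ is a GL-space (generalized-lush) if for every $x\in S_X$ and every $\varepsilon>0$ there is $x^*\in S_{X^*}$ such that, with $S=\{u\in B_X: x^*(u)\ge 1-\varepsilon\}$, one has $x\in S$ and $\rho(y,S)+\rho(-y,S)<2+\varepsilon$ for all $y\in S_X$. A subset $A\subset B_X$ is plump if for every $y\in S_X$ there are $a_1,a_2\in A$ with $\|y-a_1\|+\|y+a_2\|\le 2$. *)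

(* Defs.v *)
From HB Require Import structures.
From mathcomp Require Import all_boot all_order all_algebra.
From mathcomp Require Import all_classical all_reals all_analysis.

Set Implicit Arguments.
Unset Strict Implicit.
Unset Printing Implicit Defensive.

Import Order.TTheory GRing.Theory Num.Theory.
Import numFieldNormedType.Exports.

Local Open Scope classical_set_scope.
Local Open Scope ring_scope.

(* Finite-dimensional Banach spaces: the norm is arbitrary, the vectType
   structure provides \dim {:X} and the subspaces {vspace X}. *)
#[short(type="finDimBanachType")]
HB.structure Definition FinDimBanach (R : realType) :=
  {X of Vector R X & CompleteNormedModule R X}.

Definition unit_ball (R : realType) (X : normedModType R) : set X :=
  [set x | `|x| <= 1].

Definition unit_sphere (R : realType) (X : normedModType R) : set X :=
  [set x | `|x| = 1].

Arguments unit_ball {R} X.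
Arguments unit_sphere {R} X.

(* [sup] is 0 on unbounded sets; this is harmless below, where f is always
   required to be continuous, hence bounded on the unit ball. *)
Definition dual_norm (R : realType) (X : normedModType R)
    (f : {linear X -> R^o}) : R :=
  sup [set `|f u| | u in unit_ball X].

Definition dual_unit_sphere (R : realType) (X : normedModType R) :
    set {linear X -> R^o} :=
  [set f : {linear X -> R^o} | continuous f /\ dual_norm f = 1].

Arguments dual_unit_sphere {R} X.

Definition dist_set (R : realType) (X : normedModType R) (x : X) (A : set X) :
    R :=
  inf [set `|x - a| | a in A].

Definition slice (R : realType) (X : normedModType R)
    (f : {linear X -> R^o}) (e : R) : set X :=
  [set u | unit_ball X u /\ 1 - e <= f u].

Definition GL_space (R : realType) (X : completeNormedModType R) : Prop :=
  forall x : X, unit_sphere X x -> forall e : R, 0 < e ->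
  exists f : {linear X -> R^o},
    [/\ dual_unit_sphere X f,
        slice f e x &
        forall y : X, unit_sphere X y ->
          dist_set y (slice f e) + dist_set (- y) (slice f e) < 2 + e].

Definition plump (R : realType) (X : normedModType R) (A : set X) : Prop :=
  A `<=` unit_ball X /\
  forall y : X, unit_sphere X y ->
    exists a1 a2 : X, [/\ A a1, A a2 & `|y - a1| + `|y + a2| <= 2].

(* The functionals are non-zero, so that every [set x | f i x <= c i] is a
   genuine closed half-space; m = 0 gives the whole space. *)
Definition polyhedron (R : realType) (X : normedModType R) (P : set X) : Prop :=
  exists (m : nat) (f : 'I_m -> {linear X -> R^o}) (c : 'I_m -> R),
    (forall i, continuous (f i) /\ exists x, f i x != 0) /\
    P = [set x | forall i, f i x <= c i].

(* Faces in the sense of convex analysis (convex extreme subsets); P itself and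
   set0 are allowed. *)
Definition face (R : realType) (X : lmodType R) (P F : set X) : Prop :=
  [/\ F `<=` P,
      convex_set (F : set (convex_lmodType X)) &
      forall (x y : X) (t : R), P x -> P y -> 0 < t -> t < 1 ->
        F (t *: x + (1 - t) *: y) -> F x /\ F y].

Definition affine_subspace (R : realType) (X : vectType R)
    (a : X) (U : {vspace X}) : set X :=
  [set x | x - a \in U].

(* The affine hull of A, i.e. the smallest affine subspace containing A, has
   dimension d. No d satisfies this when A is empty. *)
Definition has_affine_dim (R : realType) (X : vectType R)
    (A : set X) (d : nat) : Prop :=
  exists (a : X) (U : {vspace X}),
    [/\ A a,
        A `<=` affine_subspace a U,
        (forall (b : X) (W : {vspace X}), A `<=` affine_subspace b W ->
           affine_subspace a U `<=` affine_subspace b W) &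
        \dim U = d].

(* The dimension condition is written with a successor because the predecessor
   on nat is truncated at 0. *)
Definition facet (R : realType) (X : vectType R) (P F : set X) : Prop :=
  face P F /\ exists2 d : nat, has_affine_dim F d & d.+1 = \dim {:X}.

(* Main.v *)
Require Import Defs.
From HB Require Import structures.
From mathcomp Require Import all_boot all_order all_algebra.
From mathcomp Require Import all_classical all_reals all_analysis.
From mathcomp Require Import ring lra.

Set Implicit Arguments.
Unset Strict Implicit.
Unset Printing Implicit Defensive.

Import Order.TTheory GRing.Theory Num.Theory.
Import numFieldNormedType.Exports.
Import VectorInternalTheory.

Local Open Scope classical_set_scope.
Local Open Scope ring_scope.

(** A functional [f] with [f u <= `|u|] cuts the ball in the face
[exposed_face f], the points of the ball where [f] is 1. The proof studies the
set of those [f] whose face is plump.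

Compactness turns the approximate condition defining GL-spaces into an exact
one: slices of width tending to 0 converge, along an ultrafilter, to a plump
face ([plump_ultra_limit]), so every point of the sphere lies in a plump face
([GL_plump_cover]), and a limit of functionals with plump faces again has a
plump face.

Plump faces are large. If the face of [f] is plump and [`|y| = 1], the
inequality [`|y - a1| + `|y + a2| <= 2] has to be an equality, and [y] lies at
distance exactly [1 - f y] from a point [a] of the face ([plump_dist]). Then
[a - y] is [1 - f y] times a second point of the face, and [y] is a combination
of two points of it; so a plump face spans the space ([plump_spanning]). A
convex part of the ball that spans has a center [x], the barycenter of a basis
chosen in it: a functional [f] below the norm with [f x = 1] is determined by
this equality, and near [x] the whole hyperplane [f = 1] stays in the convex set
([spanning_convex_center]).

Consequently functionals with plump faces are isolated
([plump_functionals_isolated]). If the face of [f] has center [x] and [g], also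
with plump face, is nearly 1 at [x], then [plump_dist] gives a point [a] of the
face of [g] close to [x]. Near [x] the sphere is the face of [f], so [a] is
interior to the face of [f] and [x] is an endpoint of a segment of that face
with midpoint [a]; thus [g x = 1], whence [g = f]. An infinite set of such
functionals would accumulate, by compactness, at one of its members, so there
are finitely many of them ([plump_functionals_finite]). As their faces cover the
sphere, they cut out the ball, which is a polyhedron.

Finally a facet lies on the sphere, because a face with a point of norm less
than 1 is the whole ball. It is convex and covered by finitely many plump faces,
so it lies in one of them: otherwise the mean of points avoiding each of the
faces would avoid them all. The dimension hypothesis makes the facet spanning,
and prolonging a segment through its center shows that it is all of that plump
face ([facet_eq_plump_face]). *)

(** * Finite-dimensional normed spaces and compactness *)

Section FiniteDimension.
Variables (R : realType) (X : finDimBanachType R).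

Lemma normr_row_entry n (v : 'rV[R]_n) i : `|v ord0 i| <= `|v|.
Proof.
rewrite [leRHS]/Num.norm /= mx_normrE.
by apply/bigmax_geP; right => /=; exists (ord0, i).
Qed.

Lemma linear_rV_bounded n (Y : normedModType R) (f : {linear 'rV[R]_n -> Y}) :
  exists2 C, 0 <= C & forall v, `|f v| <= C * `|v|.
Proof.
exists (\sum_i `|f (delta_mx 0 i)|); first exact: sumr_ge0.
move=> v; rewrite {1}[v]row_sum_delta linear_sum /= mulr_suml.
apply: le_trans (ler_norm_sum _ _ _) _; apply: ler_sum => i _.
rewrite linearZ /= normrZ mulrC ler_wpM2l //; exact: normr_row_entry.
Qed.

Lemma linear_rV_continuous n (Y : normedModType R)
  (f : {linear 'rV[R]_n -> Y}) : continuous f.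
Proof.
have [C C0 fC] := linear_rV_bounded f.
apply: bounded_linear_continuous; apply/bounded_funP => r.
exists (C * r) => x xr; apply: le_trans (fC x) _; exact: ler_wpM2l.
Qed.

(** The norm of [X] attains a minimum on the unit sphere of coordinate space,
which is compact, and that minimum is positive. *)
Lemma v2r_bounded : exists2 C, 0 <= C & forall x : X, `|v2r x| <= C * `|x|.
Proof.
pose S := [set v : 'rV[R]_(dim X) | `|v| = 1].
have [S0|S0] := pselect (S !=set0); last first.
  exists 0 => // x; have [->|x0] := eqVneq (v2r x) 0.
    by rewrite normr0 mul0r.
  case: S0; exists (`|v2r x|^-1 *: v2r x).
  by rewrite /S /= normrZ normfV normr_id mulVf // normr_eq0.
have cS : compact S.
  apply: bounded_closed_compact.
    by exists 1; split; [exact: num_real|move=> M M1 v /= ->; exact: ltW].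
  apply: (preimage_closed (f := fun v : 'rV[R]_(dim X) => `|v|) (D := [set 1])).
    by move=> v _; apply: norm_continuous.
  exact: closed_eq.
have cr2v : continuous (fun v : 'rV[R]_(dim X) => `|r2v v|).
  move=> v; apply: continuous_comp; last exact: norm_continuous.
  exact: linear_rV_continuous.
have [c Sc minc] := compact_EVT_min S0 cS (continuous_subspaceT cr2v).
have m0 : 0 < `|r2v c|.
  rewrite normr_gt0; apply/eqP => c0; move: Sc; rewrite inE /S /=.
  have -> : c = 0 by apply: (can_inj r2vK); rewrite c0 linear0.
  by rewrite normr0 => /eqP; rewrite eq_sym oner_eq0.
exists `|r2v c|^-1; first by rewrite invr_ge0.
move=> x; have [->|x0] := eqVneq (v2r x) 0.
  by rewrite normr0 mulr_ge0 // invr_ge0.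
rewrite ler_pdivlMl //; have nx : 0 < `|v2r x| by rewrite normr_gt0.
have := minc (`|v2r x|^-1 *: v2r x); rewrite inE /S /= normrZ normfV normr_id.
rewrite mulVf ?gt_eqF // => /(_ erefl).
by rewrite linearZ /= v2rK normrZ normfV normr_id ler_pdivlMl // mulrC.
Qed.

Lemma linear_findim_bounded (f : {linear X -> R^o}) :
  exists2 C, 0 <= C & forall x, `|f x| <= C * `|x|.
Proof.
have [C C0 hC] := v2r_bounded.
have [D D0 hD] := linear_rV_bounded (f \o r2v : {linear _ -> _}).
exists (D * C) => [|x]; first exact: mulr_ge0.
have := hD (v2r x); rewrite /= v2rK => /le_trans; apply.
by rewrite -mulrA ler_wpM2l.
Qed.

Lemma linear_findim_continuous (f : {linear X -> R^o}) : continuous f.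
Proof.
have [C C0 fC] := linear_findim_bounded f.
apply: bounded_linear_continuous; apply/bounded_funP => r.
exists (C * r) => x xr; apply: le_trans (fC x) _; exact: ler_wpM2l.
Qed.

Lemma unit_ball_compact : compact (unit_ball X).
Proof.
have -> : unit_ball X = (r2v : _ -> X) @` [set v | `|r2v v : X| <= 1].
  apply/seteqP; split => [x x1|_ [v v1 <-]] //.
  by exists (v2r x); rewrite /= ?v2rK.
apply: continuous_compact.
  exact/continuous_subspaceT/linear_rV_continuous.
apply: bounded_closed_compact.
  have [C C0 hC] := v2r_bounded.
  exists C; split; [exact: num_real|move=> M /ltW CM v /= v1].
  have := hC (r2v v); rewrite r2vK => /le_trans; apply.
  by apply: le_trans CM; rewrite ler_piMr.
apply: (preimage_closed (f := fun v : 'rV[R]_(dim X) => `|r2v v : X|)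
  (D := [set x | x <= 1])).
  move=> v _; apply: continuous_comp; last exact: norm_continuous.
  exact: linear_rV_continuous.
exact: closed_le.
Qed.

End FiniteDimension.

Section UltraLimits.

Lemma ultra_fmap (I T : Type) (U : set_system I) (a : I -> T) :
  UltraFilter U -> UltraFilter (a @ U).
Proof.
move=> UU; split; first exact: fmap_proper_filter.
move=> G GF sUG; apply/seteqP; split => // B GB.
have [//|nB] := in_ultra_setVsetC (a @^-1` B) UU.
have GnB : G (~` B) by apply: sUG.
by have /filter_ex [? []] : G (B `&` ~` B) by exact: filterI.
Qed.

(** This replaces the extraction of subsequences: a single ultrafilter makes all
the families of points and of values converge at once. *)
Lemma compact_ultra_cvg (I : Type) (T : topologicalType) (K : set T)
    (U : set_system I) (a : I -> T) :
  compact K -> UltraFilter U -> (forall i, K (a i)) ->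
  exists2 l, K l & a @ U --> l.
Proof.
rewrite compact_ultra => cK UU Ka.
have UK : U (a @^-1` K) by apply: filterS filterT => i _; exact: Ka.
by have [l [Kl al]] := cK _ (ultra_fmap a UU) UK; exists l.
Qed.

End UltraLimits.

(** * Plump faces as limits of slices *)

Section PlumpFaces.
Variables (R : realType) (X : finDimBanachType R).
Implicit Types (f g : 'Hom(X, R^o)).

Definition below_norm f := forall u, f u <= `|u|.

Definition exposed_face f : set X := [set u | unit_ball X u /\ f u = 1].

Definition plump_functionals : set 'Hom(X, R^o) :=
  [set f | below_norm f /\ plump (exposed_face f)].

Lemma below_norm_normr f : below_norm f -> forall u, `|f u| <= `|u|.
Proof.
move=> f1 u; rewrite ler_norml f1 andbT lerNl.
by have := f1 (- u); rewrite linearN normrN.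
Qed.

(** Compactness of the dual ball for pointwise convergence: linearity and the
bound by the norm pass to limits of values. *)
Lemma ultra_limit_functional (I : Type) (U : set_system I) (UU : UltraFilter U)
    (g : I -> 'Hom(X, R^o)) :
  (forall i, below_norm (g i)) ->
  exists2 f, below_norm f & forall u, (fun i => g i u : R) @ U --> (f u : R).
Proof.
move=> g1.
have /choice [F hF] : forall u : X, exists l : R,
    l <= `|u| /\ (fun i => g i u : R) @ U --> l.
  move=> u.
  have [i|l] := @compact_ultra_cvg I R `[- `|u|, `|u|]%classic U
      (fun i => g i u : R) (@segment_compact _ _ _) UU.
    by rewrite /= in_itv /= -ler_norml; exact: below_norm_normr.
  by rewrite /= in_itv /= => /andP[_ lu] gl; exists l.
have Flin : linear (F : X -> R^o).
  move=> k u v; have [_ hkuv] := hF (k *: u + v).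
  apply: (cvg_unique (@norm_hausdorff _ _) hkuv) => /=.
  rewrite (_ : (fun i => _) = (fun i => k *: (g i u : R^o) + g i v));
    last first.
    by apply/funext => i; rewrite linearP.
  apply: cvgD; last by case: (hF v).
  by apply: cvgZr; case: (hF u).
pose FL : {linear X -> R^o} := HB.pack (F : X -> R^o)
  (GRing.isLinear.Build R X R^o *:%R (F : X -> R^o) Flin).
exists (linfun FL) => u; rewrite lfunE /=; by case: (hF u).
Qed.

(** The witnesses of plumpness converge along [U] because the ball is compact,
and evaluation passes to the limit since functionals below the norm are
1-Lipschitz. With [e] constantly 0 this says that plump faces are stable under
limits; with [e] tending to 0 it makes the GL condition exact. *)
Lemma plump_ultra_limit (I : Type) (U : set_system I) (UU : UltraFilter U)
    (g : I -> 'Hom(X, R^o)) (e : I -> R) :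
  (forall i, below_norm (g i)) -> e @ U --> 0 ->
  (forall i y, unit_sphere X y -> exists a1 a2 : X,
    [/\ slice (g i) (e i) a1, slice (g i) (e i) a2 &
        `|y - a1| + `|y + a2| <= 2 + e i]) ->
  exists2 f, plump_functionals f &
    forall u, (fun i => g i u : R) @ U --> (f u : R).
Proof.
move=> g1 e0 gplump.
have [f f1 gf] := ultra_limit_functional UU g1.
exists f => //; split => //; split=> [u [] //|y y1].
have /choice [a ha] : forall i, exists a : X * X,
    [/\ slice (g i) (e i) a.1, slice (g i) (e i) a.2 &
        `|y - a.1| + `|y + a.2| <= 2 + e i].
  by move=> i; have [a1 [a2 h]] := gplump i y y1; exists (a1, a2).
have lim_slice (b : I -> X) : (forall i, slice (g i) (e i) (b i)) ->
    exists2 l, exposed_face f l & b @ U --> l.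
  move=> hb; have b1 i : unit_ball X (b i) by case: (hb i).
  have [l l1 bl] := compact_ultra_cvg (@unit_ball_compact R X) UU b1.
  exists l => //; split => //; apply/eqP; rewrite eq_le; apply/andP; split.
    exact: le_trans (f1 l) l1.
  have : (fun i => g i l + `|b i - l| + e i : R) @ U -->
      (f l + `|l - l| + 0 : R).
    apply: cvgD => //; apply: cvgD; first exact: gf.
    have : (fun i => b i - l) @ U --> l - l.
      by apply: cvgB => //; exact: cvg_cst.
    by move=> /cvg_norm.
  rewrite subrr normr0 !addr0 => h; apply: (cvgr_to_ge h).
  apply: filterE => i; have [_] := hb i.
  have : g i (b i) - g i l <= `|b i - l| by rewrite -linearB; exact: g1.
  by move=> /= h1 h2; lra.
have [i|l1 fl1 al1] := lim_slice (fst \o a); first by case: (ha i).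
have [i|l2 fl2 al2] := lim_slice (snd \o a); first by case: (ha i).
exists l1, l2; split => //; rewrite -[leRHS]addr0.
have h1 : (fun i => `|y - (a i).1| + `|y + (a i).2| : R) @ U -->
    (`|y - l1| + `|y + l2| : R).
  have ya1 : (fun i => `|y - (a i).1| : R) @ U --> `|y - l1|.
    exact: cvg_norm (cvgB (cvg_cst y) al1).
  have ya2 : (fun i => `|y + (a i).2| : R) @ U --> `|y + l2|.
    exact: cvg_norm (cvgD (cvg_cst y) al2).
  exact: cvgD ya1 ya2.
have h2 : (fun i => 2 + e i : R) @ U --> (2 + 0 : R).
  by apply: cvgD => //; exact: cvg_cst.
rewrite -subr_ge0; apply: (cvgr_to_ge (cvgB h2 h1)).
by apply: filterE => i; rewrite subr_ge0; case: (ha i).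
Qed.

Lemma exposed_face_slice f : exposed_face f `<=` slice f 0.
Proof. by move=> u [u1 fu]; split => //=; rewrite fu subr0. Qed.

Lemma dual_unit_sphere_normr (f : {linear X -> R^o}) :
  dual_unit_sphere X f -> forall u, `|f u| <= `|u|.
Proof.
move=> [_ f1] u; have [->|u0] := eqVneq u 0; first by rewrite linear0 !normr0.
have nu : 0 < `|u| by rewrite normr_gt0.
have [C C0 fC] := linear_findim_bounded f.
have : `|f (`|u|^-1 *: u)| <= 1.
  rewrite -f1; apply: sup_ubound.
    exists C => _ [v v1 <-]; apply: le_trans (fC v) _.
    by rewrite ler_piMr.
  exists (`|u|^-1 *: u) => //.
  by rewrite /unit_ball /= normrZ normfV normr_id mulVf ?gt_eqF.
by rewrite linearZ /= normrZ normfV normr_id ler_pdivrMl ?mulr1.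
Qed.

Lemma dist_set_lt (x : X) (A : set X) (r : R) :
  A !=set0 -> dist_set x A < r -> exists2 a, A a & `|x - a| < r.
Proof.
move=> [a0 Aa0] xr.
have [||_ [a Aa <-] ar] := inf_adherent (E := [set `|x - a| | a in A])
  (eps := r - dist_set x A).
- by rewrite subr_gt0.
- split; first by exists `|x - a0|, a0.
  by exists 0 => _ [a _ <-].
- exists a => //; apply: lt_le_trans ar _.
  by rewrite -/(dist_set x A) subrKC.
Qed.

(** The GL condition at [x] with widths [1 / n.+1] gives slices through [x] to
which the limit argument applies; the infima in it are strict, so they leave
room to choose points that nearly realize them. *)
Lemma GL_plump_cover : GL_space X ->
  forall x, unit_sphere X x -> exists2 f, plump_functionals f & f x = 1.
Proof.
move=> hX x x1.
have /choice [g hg] : forall n : nat, exists g : 'Hom(X, R^o), [/\ below_norm g,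
    slice g (n.+1%:R^-1) x & forall y, unit_sphere X y -> exists a1 a2 : X,
    [/\ slice g n.+1%:R^-1 a1, slice g n.+1%:R^-1 a2 &
        `|y - a1| + `|y + a2| <= 2 + n.+1%:R^-1]].
  move=> n; set e : R := n.+1%:R^-1.
  have e0 : 0 < e by rewrite invr_gt0.
  have [h [h1 hx hy]] := hX x x1 e e0.
  have sE : slice (linfun h) e = slice h e.
    apply/seteqP; split => u [u1 /=] hu; split => //=; move: hu;
    by rewrite lfunE.
  exists (linfun h); split.
  - move=> u; rewrite lfunE /=.
    exact: le_trans (ler_norm _) (dual_unit_sphere_normr h1 u).
  - by rewrite sE.
  move=> y y1; rewrite sE; have s0 : slice h e !=set0 by exists x.
  have sum_lt := hy y y1.
  (* Half of the slack in the GL inequality for each of the two distances. *)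
  pose d := (2 + e - dist_set y (slice h e) - dist_set (- y) (slice h e)) / 2.
  have [||a1 sa1 ya1] := @dist_set_lt y (slice h e)
    (dist_set y (slice h e) + d) => //.
    by rewrite /d; lra.
  have [||a2 sa2 ya2] := @dist_set_lt (- y) (slice h e)
    (dist_set (- y) (slice h e) + d) => //.
    by rewrite /d; lra.
  exists a1, a2; split=> //; rewrite -(normrN (y + a2)) opprD; move: ya1 ya2.
  by rewrite /d; lra.
have [U [UU sU]] := ultraFilterLemma (@eventually_filter).
have e0 : (fun n => n.+1%:R^-1 : R) @ U --> 0.
  by apply: cvg_trans (@cvg_harmonic R) => A /sU.
have [i|i y y1|f pf gf] := plump_ultra_limit UU (g := g) _ e0.
- by case: (hg i).
- by have [_ _] := hg i; apply.
exists f => //; apply/eqP; rewrite eq_le; apply/andP; split.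
  by case: pf => f1 _; rewrite -x1; exact: f1.
have h2 : (fun i => 1 - i.+1%:R^-1 : R) @ U --> (1 - 0 : R).
  by apply: cvgB => //; exact: cvg_cst.
rewrite -[X in X <= _]subr0 -subr_ge0.
apply: (cvgr_to_ge (cvgB (gf x) h2)).
by apply: filterE => i; rewrite subr_ge0; have [_ []] := hg i.
Qed.

End PlumpFaces.

(** * Convex sets that span the space *)

Section Convexity.
Variables (R : realType) (X : lmodType R).

Lemma convex_set_mem (C : set X) (x y : X) (t : R) :
  convex_set (C : set (convex_lmodType X)) -> C x -> C y -> 0 < t -> t < 1 ->
  C (t *: x + (1 - t) *: y).
Proof.
move=> cC Cx Cy t0 t1.
have := cC x y (Itv01 (ltW t0) (ltW t1)).
rewrite !inE => /(_ Cx Cy); exact.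
Qed.

(** A partial sum divided by the sum [s] of its weights is in [C]; this makes
sense only for [s] positive, hence the separate case of the empty sum in the
invariant [K]. *)
Lemma convex_set_sum (C : set X) (I : finType) (w : I -> R) (e : I -> X) :
  convex_set (C : set (convex_lmodType X)) ->
  (forall i, C (e i)) -> (forall i, 0 < w i) -> \sum_i w i = 1 ->
  C (\sum_i w i *: e i).
Proof.
move=> cC Ce w0 w1.
pose K (v : X) (s : R) := s = 0 /\ v = 0 \/ 0 < s /\ C (s^-1 *: v).
have : K (\sum_i w i *: e i) (\sum_i w i).
  apply: (big_ind2 K) => [|v1 s1 v2 s2|i _]; first by left.
    move=> [[-> ->]|[s10 C1]]; first by rewrite !add0r.
    move=> [[-> ->]|[s20 C2]]; first by rewrite !addr0; right.
    have s0 : 0 < s1 + s2 by rewrite addr_gt0.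
    right; split => //.
    have -> : (s1 + s2)^-1 *: (v1 + v2) = (s1 / (s1 + s2)) *: (s1^-1 *: v1) +
        (1 - s1 / (s1 + s2)) *: (s2^-1 *: v2).
      rewrite !scalerA scalerDr; congr (_ *: _ + _ *: _); field;
      by rewrite ?gt_eqF.
    apply: convex_set_mem => //; first exact: divr_gt0.
    by rewrite ltr_pdivrMr // mul1r ltrDl.
  by right; rewrite scalerA mulVf ?scale1r ?gt_eqF.
rewrite w1 => -[[/eqP]|[_]]; first by rewrite oner_eq0.
by rewrite invr1 scale1r.
Qed.

End Convexity.

Section Spanning.
Variables (R : realType) (X : vectType R).

Definition spanning (C : set X) :=
  forall W : {vspace X}, (forall x, C x -> x \in W) -> W = fullv.

Lemma spanning_basis (C : set X) :
  spanning C -> exists2 e : (\dim {:X}).-tuple X,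
    basis_of fullv e & forall i : 'I_(\dim {:X}), C e`_i.
Proof.
move=> sC.
have extend k : (k <= \dim {:X})%N ->
    exists bs : seq X, [/\ size bs = k, free bs & forall x, x \in bs -> C x].
  elim: k => [|k IH kn]; first by exists [::]; rewrite nil_free.
  have [bs [sk fs Cs]] := IH (ltnW kn).
  have [x Cx xs] : exists2 x, C x & x \notin <<bs>>%VS.
    apply: contrapT => nx; have sfull : <<bs>>%VS = fullv.
      apply: sC => x Cx; apply: contrapT => /negP xs.
      by apply: nx; exists x.
    by move: fs; rewrite /free sfull sk => /eqP dk; rewrite -dk ltnn in kn.
  exists (x :: bs); split; rewrite /= ?sk ?free_cons ?xs // => y.
  by rewrite inE => /predU1P[->|/Cs].
have [bs [sn fs Cs]] := extend _ (leqnn _).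
have sn' : size bs == \dim {:X} by apply/eqP.
exists (Tuple sn') => [|i].
  by rewrite basisEfree fs subvf /= sn leqnn.
by apply: Cs; rewrite mem_nth // sn.
Qed.

End Spanning.

Section Barycenter.
Variables (R : realType) (X : finDimBanachType R).
Implicit Types (f g : 'Hom(X, R^o)).

(** An average of numbers at most 1 that equals 1 has all its terms equal
to 1. *)
Lemma below_norm_mean f (I : finType) (w : I -> R) (e : I -> X) :
  below_norm f -> (forall i, 0 < w i) -> \sum_i w i = 1 ->
  (forall i, `|e i| <= 1) -> f (\sum_i w i *: e i) = 1 -> forall i, f (e i) = 1.
Proof.
move=> f1 w0 w1 e1 fe i.
have fe1 j : f (e j) <= 1 by apply: le_trans (f1 _) (e1 j).
have wf j : true -> 0 <= w j * (1 - f (e j)).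
  by move=> _; rewrite mulr_ge0 ?subr_ge0 // ltW.
have s0 : \sum_j w j * (1 - f (e j)) = 0.
  under eq_bigr do rewrite mulrBr mulr1; rewrite sumrB w1.
  apply/eqP; rewrite subr_eq0 eq_sym -fe linear_sum /=; apply/eqP.
  by apply: eq_bigr => j _; rewrite linearZ.
have /eqP := psumr_eq0P wf s0 (i := i) isT.
by rewrite mulf_eq0 gt_eqF //= subr_eq0 => /eqP <-.
Qed.

(** The center is the barycenter of a basis [e] chosen in [C]. By
[below_norm_mean], [f x = 1] forces [f] to be 1 on [e], which determines [f] and
makes [f u] the sum of the coordinates of [u]; near [x] these coordinates are
positive, so that [u] with [f u = 1] is a convex combination of [e]. *)
Lemma spanning_convex_center (C : set X) :
  (0 < \dim {:X})%N -> convex_set (C : set (convex_lmodType X)) ->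
  C `<=` unit_ball X -> spanning C ->
  exists2 x, C x & exists2 d : R, 0 < d & forall f, below_norm f -> f x = 1 ->
    (forall g, below_norm g -> g x = 1 -> g = f) /\
    (forall u, f u = 1 -> `|u - x| < d -> C u).
Proof.
move=> n0 cC C1 sC; have [e be Ce] := spanning_basis sC.
have e1 (i : 'I_(\dim {:X})) : `|e`_i| <= 1 by exact: (C1 _ (Ce i)).
set n := \dim {:X} in n0 e be Ce e1 *.
have nR : 0 < (n%:R : R) by rewrite ltr0n.
pose w (i : 'I_n) : R := n%:R^-1.
have w0 i : 0 < w i by rewrite invr_gt0.
have w1 : \sum_i w i = 1.
  rewrite sumr_const card_ord -[LHS]mulr_natl; apply: divff.
  exact: lt0r_neq0.
pose x := \sum_i w i *: e`_i.
have coordx i : coord e i x = w i by rewrite coord_sum_free // (basis_free be).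
have /choice [B hB] : forall i : 'I_n, exists B : R,
    0 <= B /\ forall u, `|coord e i u| <= B * `|u|.
  by move=> i; have [B B0 hB] := linear_findim_bounded (coord e i); exists B.
(* A common Lipschitz constant of the coordinates; the coordinates of [x] are
   [1 / n], so they stay positive within distance [1 / (n * M)] of [x]. *)
pose M := 1 + \sum_i B i.
have M0 : 0 < M by rewrite ltr_pwDl // sumr_ge0 // => i _; case: (hB i).
exists x; first exact: convex_set_sum.
exists (n%:R^-1 / M); first by rewrite divr_gt0 // invr_gt0.
move=> f f1 fx; have fe := below_norm_mean f1 w0 w1 e1 fx.
have fE g u : g u = \sum_i coord e i u * g e`_i.
  rewrite {1}(coord_basis be (memvf u)) linear_sum.
  by apply: eq_bigr => i _; rewrite linearZ.
split=> [g g1 gx|u fu ux].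
  have ge := below_norm_mean g1 w0 w1 e1 gx.
  by apply/lfunP => u; rewrite !fE; apply: eq_bigr => i _; rewrite ge fe.
rewrite (coord_basis be (memvf u)); apply: convex_set_sum => //; last first.
  by rewrite -fu fE; apply: eq_bigr => i _; rewrite fe mulr1.
move=> i; have [Bi0 hBi] := hB i.
have : `|coord e i (u - x)| < n%:R^-1.
  apply: le_lt_trans (hBi _) _.
  have : B i * `|u - x| <= M * `|u - x|.
    rewrite ler_wpM2r // /M (bigD1 i) //=.
    have : 0 <= \sum_(j | j != i) B j by apply: sumr_ge0 => j _; case: (hB j).
    by move=> h; lra.
  by move=> /le_lt_trans; apply; rewrite mulrC -ltr_pdivlMr.
rewrite linearB /= coordx /w ltr_norml => /andP[h _]; by move: h; lra.
Qed.

End Barycenter.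

(** * Finiteness of the set of plump faces *)

Section Finiteness.
Variables (R : realType) (X : finDimBanachType R).
Implicit Types (f g : 'Hom(X, R^o)).

Lemma exposed_face_convex f :
  convex_set (exposed_face f : set (convex_lmodType X)).
Proof.
move=> x y t; rewrite !inE => -[x1 fx] [y1 fy].
have -> : conv t x y = t%:num *: (x : X) + (1 - t%:num) *: (y : X) by [].
have t0 : 0 <= t%:num :> R by [].
have t1 : 0 <= 1 - t%:num :> R by rewrite subr_ge0.
split.
  rewrite /unit_ball /=; apply: le_trans (ler_normD _ _) _.
  rewrite !normrZ !ger0_norm //; move: x1 y1; rewrite /unit_ball /= => x1 y1.
  have := ler_wpM2l t0 x1; have := ler_wpM2l t1 y1; lra.
by rewrite linearD !linearZ /= fx fy /GRing.scale /= !mulr1 addrC subrK.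
Qed.

(** Applied to [a1 - y] and to [y + a2], the bound [f <= norm] gives
[1 - f y <= `|y - a1|] and [1 + f y <= `|y + a2|]. The left sides add up to 2
and the right sides to at most 2, so both are equalities. *)
Lemma plump_dist f y : plump_functionals f -> unit_sphere X y ->
  exists2 a, exposed_face f a & `|y - a| = 1 - f y.
Proof.
move=> [f1 [_ pf]] y1; have [a1 [a2 [[a11 fa1] [a21 fa2] h]]] := pf y y1.
exists a1 => //.
have h1 : f (a1 - y) <= `|y - a1| by rewrite distrC; exact: f1.
have h2 := f1 (y + a2); move: h1 h2; rewrite linearB linearD /= fa1 fa2.
by move=> h1 h2; apply/eqP; rewrite eq_le; apply/andP; split; lra.
Qed.

(** With [a] from [plump_dist], the vector [(1 - f z)^-1 *: (a - z)] has norm 1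
and value 1 under [f], so it lies in the face and [z] is a combination of it and
[a]. *)
Lemma plump_spanning f : plump_functionals f -> spanning (exposed_face f).
Proof.
move=> pf W hW; apply/vspaceP => y; rewrite memvf.
have [->|y0] := eqVneq y 0; first by rewrite mem0v.
have ny : `|y| != 0 by rewrite normr_eq0.
have -> : y = `|y| *: (`|y|^-1 *: y) by rewrite scalerA mulfV // scale1r.
rewrite memvZ //; set z := `|y|^-1 *: y.
have z1 : unit_sphere X z.
  by rewrite /unit_sphere /= normrZ normfV normr_id mulVf.
have [a fa za] := plump_dist pf z1.
have [fz|fz] := eqVneq (1 - f z) 0.
  move: za; rewrite fz => /eqP; rewrite normr_eq0 subr_eq0 => /eqP ->.
  exact: hW.
have fz0 : 0 < 1 - f z by rewrite lt_neqAle eq_sym fz -za normr_ge0.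
have -> : z = a - (1 - f z) *: ((1 - f z)^-1 *: (a - z)).
  by rewrite scalerA mulfV // scale1r opprB addrC subrK.
apply: memvB; first exact: hW.
apply/memvZ/hW; split.
  rewrite /unit_ball /= normrZ normfV (distrC a) za.
  by rewrite gtr0_norm // mulVf.
by case: fa => _ fa; rewrite linearZ linearB /= fa; exact: mulVf.
Qed.

Lemma nonprincipal_ultrafilter (I : Type) : infinite_set [set: I] ->
  exists2 U : set_system I, UltraFilter U & forall A, cofinite_set A -> U A.
Proof.
move=> iI; pose F : set_system I := [set A | cofinite_set A].
have FF : ProperFilter F.
  split; first by rewrite /F /= setC0.
  split.
  - by rewrite /F /= setCT.
  - by move=> A B FA FB; rewrite /F /= setCI finite_setU.
  - by move=> A B AB; apply: sub_finite_set => i; apply: contra_not => /AB.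
by have [U [UU FU]] := ultraFilterLemma FF; exists U.
Qed.

(** Near the center [x] of the face of [f], the sphere coincides with that face.
The point [a] of the face of [g] at distance [1 - g x] from [x] is therefore in
the face of [f], and so is the reflection [b] of [x] through [a]; since [g] is 1
at the midpoint [a] of [x] and [b], it is 1 at [x]. *)
Lemma plump_functionals_isolated f :
  (0 < \dim {:X})%N -> plump_functionals f ->
  exists2 x, f x = 1 & exists2 d : R, 0 < d &
    forall g, plump_functionals g -> 1 - d < g x -> g = f.
Proof.
move=> n0 pf; have [f1 _] := pf.
have f_ball : exposed_face f `<=` unit_ball X by move=> u [].
have [x [x1 fx] [d d0 hx]] := spanning_convex_center n0
  (@exposed_face_convex f) f_ball (plump_spanning pf).
have [fuq fin] := hx f f1 fx.
(* [r <= 1/2] keeps [f a] away from 0, so that the normalization [u] of [a]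
   satisfies [`|u - x| < 3 * r <= d]; the reflection needs [2 * r <= d]. *)
pose r := Num.min (1 / 2) (d / 4).
have r0 : 0 < r by rewrite lt_min !divr_gt0.
have r2 : r <= 1 / 2 by rewrite ge_min lexx.
have r4 : r <= d / 4 by rewrite ge_min lexx orbT.
exists x => //; exists r => // g pg gx; have [g1 _] := pg.
have xs : unit_sphere X x.
  apply/eqP; rewrite eq_le; apply/andP; split => //.
  by rewrite -fx; exact: f1.
have [a [a1 ga] xa] := plump_dist pg xs.
have xar : `|x - a| < r by rewrite xa; lra.
have fa : 1 - r < f a.
  have := f1 (x - a); rewrite linearB /= fx => h.
  by rewrite ltrBlDr -ltrBlDl; apply: le_lt_trans xar.
have fa0 : 0 < f a by lra.
have fa1 : f a <= 1 by exact: le_trans (f1 _) a1.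
pose u := (f a)^-1 *: a.
have [u1 _] : exposed_face f u.
  apply: fin; first by rewrite linearZ /=; apply: mulVf; rewrite gt_eqF.
  have -> : u - x = (1 - f a) *: u - (x - a).
    rewrite scalerBl scale1r {3}/u scalerA mulfV ?gt_eqF // scale1r opprB.
    by rewrite addrA subrK.
  apply: le_lt_trans (ler_normB _ _) _.
  rewrite normrZ /u normrZ normfV (gtr0_norm fa0) ger0_norm ?subr_ge0 //.
  have : (f a)^-1 <= 2.
    by rewrite -[leRHS]invrK lef_pV2 ?posrE ?invr_gt0 //; lra.
  move=> h; have h' : (f a)^-1 * `|a| <= 2 * 1.
    by apply: ler_pM => //; rewrite invr_ge0 ltW.
  have : (1 - f a) * ((f a)^-1 * `|a|) <= r * (2 * 1).
    apply: ler_pM => //; [by lra| |by lra].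
    by rewrite mulr_ge0 // invr_ge0 ltW.
  by lra.
(* [`|u| <= 1] reads [`|a| <= f a], whereas [`|a| >= g a = 1]. *)
have fa_eq : f a = 1.
  move: u1; rewrite /unit_ball /u /= normrZ normfV (gtr0_norm fa0).
  rewrite ler_pdivrMl // mulr1 => afa.
  have := g1 a; rewrite ga => ag; lra.
pose b := a + (a - x).
have [b1 _] : exposed_face f b.
  apply: fin; first by rewrite linearD linearB /= fa_eq fx subrr addr0.
  have -> : b - x = (a - x) + (a - x) by rewrite /b addrAC.
  apply: le_lt_trans (ler_normD _ _) _; rewrite distrC; lra.
apply: fuq => //; apply/eqP; rewrite eq_le; apply/andP; split.
  exact: le_trans (g1 _) x1.
have : g b <= 1 by exact: le_trans (g1 _) b1.
by rewrite linearD linearB /= ga; lra.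
Qed.

(** A nonprincipal ultrafilter on an infinite set of functionals would converge
to a member [f] of the set while avoiding [f], against isolation. *)
Lemma plump_functionals_finite :
  (0 < \dim {:X})%N -> finite_set (@plump_functionals R X).
Proof.
move=> n0; apply: contrapT => iPhi.
pose I := {f : 'Hom(X, R^o) | plump_functionals f}.
have iI : infinite_set [set: I].
  apply: contra_not iPhi => /(finite_image (fun i : I => sval i)).
  by apply: sub_finite_set => f pf; exists (exist _ f pf).
have [U UU cU] := nonprincipal_ultrafilter iI.
have [i||i y y1|f pf hf] := plump_ultra_limit UU (g := sval) (e := fun=> 0).
- by case: (svalP i).
- exact: cvg_cst.
- have [_ [_ /(_ y y1)]] := svalP i => -[a1 [a2 [h1 h2 h3]]].
  by exists a1, a2; rewrite addr0; split => //; exact: exposed_face_slice.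
have [x fx [d d0 fd]] := plump_functionals_isolated n0 pf.
have U1 : U [set i : I | 1 - d < sval i x].
  have /cvgr_gt := hf x; apply; rewrite fx; lra.
have U2 : U [set i : I | sval i <> f].
  apply: cU; apply: (@sub_finite_set _ _ [set exist _ f pf]);
    last exact: finite_set1.
  by move=> [g pg] /= /contrapT gf; apply: eq_exist.
have [i [/= h1 h2]] := filter_ex (filterI U1 U2).
by apply: h2; apply: fd => //; exact: svalP.
Qed.

End Finiteness.

(** * The unit ball as a polyhedron and its facets *)

Section Facets.
Variables (R : realType) (X : finDimBanachType R).
Implicit Types (f g : 'Hom(X, R^o)).

(** A point [x] of norm greater than 1 is cut off by a functional that is 1 at
[`|x|^-1 *: x]: its value at [x] is [`|x|]. *)
Lemma unit_ball_plump : GL_space X ->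
  unit_ball X = [set x | forall f, plump_functionals f -> f x <= 1].
Proof.
move=> hX; apply/seteqP; split=> [x x1 f [f1 _]|x hx].
  exact: le_trans (f1 x) x1.
rewrite /unit_ball /= leNgt; apply/negP => x1.
have x0 : 0 < `|x| by apply: lt_trans x1.
have [|f pf] := GL_plump_cover hX (x := `|x|^-1 *: x).
  by rewrite /unit_sphere /= normrZ normfV normr_id mulVf ?gt_eqF.
rewrite linearZ /= => fx; have := hx f pf.
have -> : f x = `|x|.
  have : `|x|^-1 * f x = 1 by [].
  by move=> /(congr1 ( *%R `|x|)); rewrite mulrA divff ?gt_eqF // mul1r mulr1.
by rewrite leNgt x1.
Qed.

Lemma GL_polyhedron : GL_space X -> polyhedron (unit_ball X).
Proof.
move=> hX; have [X0|n0] := posnP (\dim {:X}).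
  (* In dimension 0 the sphere is empty, so the zero functional has a plump
     face although it defines no half-space; the ball is the whole space. *)
  exists 0%N, (fun=> (0 : 'Hom(X, R^o))), (fun=> 0); split; first by case.
  apply/seteqP; split => [x _ []//|x _].
  have : x \in (0%VS : {vspace X}).
    by rewrite -(eqP (_ : fullv == 0%VS)) ?memvf // -dimv_eq0 X0.
  by rewrite memv0 => /eqP ->; rewrite /unit_ball /= normr0.
have /finite_seqP [s sE] := plump_functionals_finite n0.
exists (size s), (fun i => (tnth (in_tuple s) i : 'Hom(X, R^o))), (fun=> 1).
split.
  move=> i; split; first exact: linear_findim_continuous.
  have : plump_functionals (tnth (in_tuple s) i) by rewrite sE /= mem_tnth.
  move=> /(plump_functionals_isolated n0) [x fx _]; exists x.
  by rewrite /= fx oner_eq0.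
rewrite unit_ball_plump //; apply/seteqP; split=> x /= hx.
  by move=> i; apply: hx; rewrite sE /= mem_tnth.
by move=> f; rewrite sE /= => /seq_tnthP [i ->].
Qed.

(** Here [x] lies strictly between [y] and the point obtained by prolonging the
segment from [y] to [x] beyond [x]. *)
Lemma face_prolong (P F : set X) (x y : X) (s : R) :
  face P F -> F x -> P y -> 0 < s -> P (x + s *: (x - y)) -> F y.
Proof.
move=> [_ _ extF] Fx Py s0 Pz; set z := x + _ in Pz.
pose t := s / (1 + s).
have t0 : 0 < t by rewrite divr_gt0 //; lra.
have t1 : t < 1 by rewrite ltr_pdivrMr; lra.
have [] // := extF y z t Py Pz t0 t1.
suff -> : t *: y + (1 - t) *: z = x by [].
rewrite /z scalerDr scalerA.
have -> : (1 - t) * s = t by rewrite /t; field; rewrite gt_eqF //; lra.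
by rewrite scalerBr addrCA [t *: y + _]addrC subrK -scalerDl subrK scale1r.
Qed.

Lemma face_interior_point (F : set X) (x y : X) :
  face (unit_ball X) F -> F x -> `|x| < 1 -> unit_ball X y -> F y.
Proof.
move=> fF Fx x1 y1.
pose s := (1 - `|x|) / 2; have s0 : 0 < s by rewrite divr_gt0 // subr_gt0.
have y2 : `|x - y| <= 2.
  by move: y1; rewrite /unit_ball /= => y1; have := ler_normB x y; lra.
apply: (face_prolong fF Fx y1 s0).
rewrite /unit_ball /=; apply: le_trans (ler_normD _ _) _.
rewrite normrZ gtr0_norm //.
have : s * `|x - y| <= s * 2 by rewrite ler_wpM2l // ltW.
rewrite {2}/s; lra.
Qed.

(** A face meeting the open ball is the whole ball, whose affine hull has full
dimension. *)
Lemma facet_sub_sphere (F : set X) :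
  facet (unit_ball X) F -> F `<=` unit_sphere X.
Proof.
move=> [fF [d [a [U [Fa FU _ dU]]] dn]] x Fx; have [FB _ _] := fF.
apply/eqP; rewrite eq_le FB //= leNgt; apply/negP => x1.
have BU y : unit_ball X y -> y - a \in U.
  by move=> y1; apply: FU; exact: face_interior_point fF Fx x1 y1.
have aU : a \in U.
  by rewrite -[a]opprK memvN -sub0r BU // /unit_ball /= normr0.
have : U = fullv.
  apply/vspaceP => y; rewrite memvf.
  have [->|y0] := eqVneq y 0; first by rewrite mem0v.
  have ny : `|y| != 0 by rewrite normr_eq0.
  have -> : y = `|y| *: (`|y|^-1 *: y) by rewrite scalerA mulfV // scale1r.
  apply: memvZ; rewrite -[_ *: y](subrK a); apply: memvD => //; apply: BU.
  by rewrite /unit_ball /= normrZ normfV normr_id mulVf.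
by move=> UX; move: dn; rewrite -dU UX => /eqP; rewrite eqn_leq ltnn.
Qed.

(** If for every plump face some point [y i] of [F] is outside it, the mean of
the [y i] belongs to [F], so to the sphere and to one of the plump faces; by
[below_norm_mean] all the [y i] belong to that face, a contradiction. *)
Lemma sphere_convex_in_plump_face (F : set X) :
  (0 < \dim {:X})%N -> GL_space X -> F !=set0 ->
  convex_set (F : set (convex_lmodType X)) -> F `<=` unit_sphere X ->
  exists2 f, plump_functionals f & F `<=` exposed_face f.
Proof.
move=> n0 hX [x0 Fx0] cF FS.
have /finite_seqP [s sE] := plump_functionals_finite n0.
have s_plump i : plump_functionals (tnth (in_tuple s) i).
  by rewrite sE /= mem_tnth.
apply: contrapT => no_f.
have /choice [y hy] : forall i, exists y, F y /\ tnth (in_tuple s) i y <> 1.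
  move=> i; apply: contrapT => hi; apply: no_f.
  exists (tnth (in_tuple s) i) => // y Fy; split.
    by have := FS y Fy; rewrite /unit_ball /unit_sphere /= => ->.
  by apply: contrapT => fy; apply: hi; exists y.
have s_ge x : F x -> exists i, tnth (in_tuple s) i x = 1.
  move=> /FS /(GL_plump_cover hX) [f]; rewrite sE /= => /seq_tnthP [i ->] fx.
  by exists i.
have [i0 _] := s_ge x0 Fx0.
have m0 : 0 < ((size s)%:R : R).
  by rewrite ltr0n; exact: leq_ltn_trans (ltn_ord i0).
pose w (i : 'I_(size s)) : R := (size s)%:R^-1.
have w0 i : 0 < w i by rewrite invr_gt0.
have w1 : \sum_i w i = 1.
  rewrite sumr_const card_ord -[LHS]mulr_natl; apply: divff.
  exact: lt0r_neq0.
have Fy i : F (y i) by case: (hy i).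
have [i fi] := s_ge _ (convex_set_sum cF Fy w0 w1).
have [_] := hy i; apply.
have [f1 _] := s_plump i.
apply: below_norm_mean f1 w0 w1 _ fi i => j.
by have := FS _ (Fy j); rewrite /unit_sphere /= => ->.
Qed.

(** The affine hull [a + U] of [F] avoids 0, since [f] is 1 on it; a subspace
containing [F] contains [U] and also [a], which is outside [U], so it has
dimension greater than [\dim U]. *)
Lemma facet_spanning (F : set X) f :
  facet (unit_ball X) F -> F `<=` exposed_face f -> spanning F.
Proof.
move=> [_ [d [a [U [Fa FU minU dU]]] dn]] Ff W FW.
have [_ fa] := Ff a Fa.
have aW : a \in W by exact: FW.
have UW : (U <= W)%VS.
  apply/subvP => u uU.
  have : affine_subspace 0 W (a + u).
    apply: minU => [x /FW|]; first by rewrite /affine_subspace /= subr0.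
    by rewrite /affine_subspace /= addrC addKr.
  rewrite /affine_subspace /= subr0 => auW.
  by rewrite -[u](addKr a) memvD // memvN.
have Uker : (U <= lker f)%VS.
  apply/subvP => u uU.
  have : affine_subspace a (lker f) (a + u).
    apply: minU => [x /Ff [_ fx]|].
      by rewrite /affine_subspace /= memv_ker linearB /= fx fa subrr.
    by rewrite /affine_subspace /= addrC addKr.
  by rewrite /affine_subspace /= addrC addKr.
apply/eqP; rewrite eqEdim subvf /= -dn -dU ltnNge; apply/negP => dWU.
have UeW : U = W by apply/eqP; rewrite eqEdim UW.
have : a \in lker f by apply: (subvP Uker); rewrite UeW.
by rewrite memv_ker fa oner_eq0.
Qed.

(** [F] contains the part of [f = 1] near its center [x], so the segment from
any [y] of the face of [f] to [x] can be prolonged inside [F], and extremality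
of [F] puts [y] in [F]. *)
Lemma facet_eq_plump_face (F : set X) : GL_space X ->
  facet (unit_ball X) F ->
  exists2 f, plump_functionals f & F = exposed_face f.
Proof.
move=> hX fF; have [faceF [d dF dn]] := fF; have [FB cF _] := faceF.
have n0 : (0 < \dim {:X})%N by rewrite -dn.
have F0 : F !=set0 by case: dF => [a [_ [Fa _ _ _]]]; exists a.
have [f pf Ff] := sphere_convex_in_plump_face n0 hX F0 cF (facet_sub_sphere fF).
exists f => //; apply/seteqP; split => // y [y1 fy].
have [x Fx [e e0 hx]] := spanning_convex_center n0 cF FB (facet_spanning fF Ff).
have [f1 _] := pf; have [_ fx] := Ff x Fx; have [_ fin] := hx f f1 fx.
pose s := e / (1 + 2 * `|x - y|).
have D0 : 0 < 1 + 2 * `|x - y| by have := normr_ge0 (x - y); lra.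
have s0 : 0 < s by rewrite divr_gt0.
apply: (face_prolong faceF Fx y1 s0).
apply/FB/fin.
  by rewrite linearD linearZ linearB /= fx fy subrr scaler0 addr0.
rewrite addrC addKr normrZ gtr0_norm // /s mulrAC ltr_pdivrMr // ltr_pM2l //.
have := normr_ge0 (x - y); lra.
Qed.

End Facets.

Theorem theorem2p8 (R : realType) (X : finDimBanachType R) (hX : GL_space X) :
  polyhedron (unit_ball X) /\
  forall F : set X, facet (unit_ball X) F -> plump F.
Proof.
split; first exact: GL_polyhedron.
by move=> F /(facet_eq_plump_face hX) [f [_ pf] ->].
Qed.
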